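(* Let $G$ be a finite nonabelian $2$-group that is realizable. Then: (1) If the center $Z(G)$ is cyclic, then $Z(G)$ is isomorphic to $\mathbf{C}_2$ or $\mathbf{C}_4$. (2) Each cyclic maximal abelian subgroup of $G$ is isomorphic to $\mathbf{C}_2$ or $\mathbf{C}_4$.
   Context: Rings are associative with identity, not necessarily commutative. A group is realizable if it is isomorphic to the group of units of some ring. $\mathbf{C}_m$ denotes the cyclic group of order $m$. A maximal abelian subgroup of $G$ is an abelian subgroup of $G$ that is not properly contained in any other abelian subgroup of $G$. *)

(* Defs.v *)
From mathcomp Require Import all_boot all_order all_algebra all_fingroup all_solvable.

Set Implicit Arguments.
Unset Strict Implicit.
Unset Printing Implicit Defensive.

Import GRing.Theory.

Local Open Scope ring_scope.

(* Units are taken in an arbitrary ring, so that no decidability of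
   invertibility (as in unitRingType) is imposed on the ring. *)
Definition ring_unit (R : pzRingType) (u : R) : Prop :=
  exists v : R, u * v = 1 /\ v * u = 1.

(* The ring R may be infinite; f restricts to a multiplicative bijection
   from G onto the units of R, and its values outside G are irrelevant. *)
Definition realizable (gT : finGroupType) (G : {group gT}) : Prop :=
  exists (R : pzRingType) (f : gT -> R),
    [/\ {in G &, forall x y, f (x * y)%g = f x * f y},
        {in G &, injective f}
      & forall u : R, ring_unit u <-> (exists2 x, x \in G & f x = u)].

Definition maximal_abelian (gT : finGroupType) (G A : {group gT}) : bool :=
  [max A | (A \subset G) && abelian A]%g.

(* Main.v *)
From HB Require Import structures.
Require Import Defs.
From mathcomp Require Import all_boot all_algebra all_fingroup all_solvable.
From mathcomp Require Import ring zify.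

Set Implicit Arguments.
Unset Strict Implicit.
Unset Printing Implicit Defensive.

Import GRing.Theory.
Local Open Scope ring_scope.

(** Let f embed the finite nonabelian 2-group G as the group of units of the
ring R, and let A be the center of G or a maximal abelian subgroup. A unit of R
that commutes with whatever commutes with A lies in A; hence A contains every
unit that is an integer polynomial in elements of A. When A is cyclic it has a
single involution, so at most one unit u != 1 which is such a polynomial
satisfies u^2 = 1 (bicommutes_sqrt1_eq). Assume A = <a> has order at least 8;
the proof exhibits too many units.

If 2 != 0 in R, the involution of A is -1, so some power b of f a satisfies
b^4 = -1, and s = b + 1/b = b - b^3 is a square root of 2. The unit 1 + s of
Z[sqrt 2] has finite order in R, which forces some N%:R = 0 with N > 0
(finite_char).

Write N = q m with q a power of 2 and m odd. The Chinese remainder theorem gives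
an integer e that is an idempotent of R with m e = 0 and q (1 - e) = 0, so R
splits as eR x (1 - e)R. The units of eR form an abelian group
(odd_part_abelian): a nilpotent x with m x = 0 vanishes, because 1 + x has odd
order. Since G is not abelian, the units of (1 - e)R are a nontrivial normal
subgroup of G, so they contain a central involution; it differs from the central
involution 1 - 2 e unless e = 0. A cyclic A leaves no room for two, so e = 0,
and the characteristic of R is a power of 2 (pow2_char).

It remains to treat the characteristic 2^k. If k = 1, then x = 1 + f a is
nilpotent, with a power different from zero whose exponent is at least 4, and
the two highest nonzero powers x^i both give 1 + x^i of square 1. If k >= 3, then
1 + 2^(k-1) has square 1. If k = 2, then 2 s = 0, or else 1 + 2 s is a new
element of square 1, and with 2 s = 0 the element 1 + (b^2 - 1) (1 - b) is one.

To see that the units of eR commute, let H be the corresponding subgroup of G,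
and let g in H be central modulo Z(H). For h in H put z = [g, h]; if 1 + h were
invertible, z' = [g, 1 + h] would be central too, and expanding
g (1 + h) = (1 + h) g z' exhibits h as a ratio of central elements on the part
where z - z' is invertible, while z' = z forces z = 1 on the rest. In the reduced
ring eR this reads (z - 1)^2 = 0 (odd_part_comm_corner). To make 1 + h invertible,
cut eR by the idempotents (1 + t)/2 and (1 - t)/2 for an involution t that is a
power of h: on the second part 1 + h divides 1 - t = 2, and on the first part the
order of h drops (odd_part_comm_second_center). *)

(** * Auxiliary facts on rings and groups *)

(** Membership in the bicommutant of x is the only trace kept of the fact that u is
an integer polynomial in x. *)
Definition bicommutes (R : pzRingType) (x u : R) :=
  forall r, GRing.comm r x -> GRing.comm r u.

Lemma exprD1_sq0 (R : pzRingType) (x : R) n : x * x = 0 -> (1 + x) ^+ n = 1 + x *+ n.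
Proof.
move=> x2; elim: n => [|n IHn]; first by rewrite expr0 mulr0n addr0.
rewrite exprSr IHn mulrDr mulr1 mulrDl mul1r mulrnAl x2 mul0rn addr0.
by rewrite -addrA -mulrSr.
Qed.

(** The identities of the last part take place in the commutative subring
generated by one element of R. Transporting them from {poly int} makes them
identities between polynomials. *)
Lemma int_poly_eval (R : pzRingType) (b : R) : (1 : R) != 0 ->
  exists ev : {rmorphism {poly int} -> R}, ev 'X = b.
Proof.
case: R b => T cT b nz.
pose R0 : pzRingType := GRing.PzRing.Pack cT.
pose R' : nzRingType := HB.pack T R0 (GRing.PzSemiRing_isNonZero.Build R0 nz).
have [ev evb] : exists ev : {rmorphism {poly int} -> R'}, ev 'X = b.
  have cb : commr_rmorph (intmul (1 : R')) b by move=> m; apply: commr_int.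
  by exists (horner_morph cb); rewrite /= horner_morphX.
(* The pieces of the structure R' are those of cT, which becomes visible once cT is
a constructor. *)
by destruct cT; exists ev.
Qed.

Lemma int_poly_eval_comm (R : pzRingType) (ev : {rmorphism {poly int} -> R}) r p :
  GRing.comm r (ev 'X) -> GRing.comm r (ev p).
Proof.
move=> rX; elim/poly_ind: p => [|p c IHp]; first by rewrite rmorph0; apply: commr0.
rewrite rmorphD rmorphM /=; apply: commrD; first exact: commrM.
have -> : c%:P = c%:~R by rewrite -[in LHS](intz c) rmorph_int.
by rewrite rmorph_int; apply: commr_int.
Qed.

(** Squaring preserves uv = 1 and turns the trace c into c^2 - 2, which stays
above 2. This replaces the infinite order of a unit of Z[sqrt 2]: if u had order
dividing a power of 2, the final trace would be both c' > 2 and 1 + 1. *)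
Lemma inverse_pair_pow2_sum (R : pzRingType) (u v : R) c j : u * v = 1 -> v * u = 1 ->
    u + v = c%:R -> (2 < c)%N ->
  exists2 c', (2 < c')%N & u ^+ (2 ^ j) + v ^+ (2 ^ j) = c'%:R.
Proof.
elim: j u v c => [|j IHj] u v c uv vu uvc c2; first by exists c.
rewrite expnS !exprM; apply: (IHj _ _ (c * c - 2)%N).
- by rewrite !expr2 -mulrA [u * (v * v)]mulrA uv mul1r uv.
- by rewrite !expr2 -mulrA [v * (u * u)]mulrA vu mul1r vu.
- rewrite natrB; last by nia.
  have -> : (c * c)%:R = u ^+ 2 + v ^+ 2 + 2%:R :> R; last by rewrite addrK.
  by rewrite natrM -uvc mulrDl !mulrDr uv vu -!expr2 [1 + _]addrC addrACA.
by nia.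
Qed.

(** A nontrivial nilpotent group has a nontrivial center; for H / Z(H) this says
that the second center is larger than the first. *)
Lemma noncentral_second_center (gT : finGroupType) (H : {group gT}) :
    nilpotent H -> ~~ abelian H ->
  exists g, [/\ g \in H, g \notin 'Z(H)%g
    & forall y, y \in H -> [~ g, y]%g \in 'Z(H)%g].
Proof.
move=> nilH nabH; have nZ : (H \subset 'N('Z(H)))%g := normal_norm (center_normal H).
have nilQ : nilpotent (H / 'Z(H))%g := quotient_nil _ nilH.
have Qn1 : (H / 'Z(H))%g != 1%g.
  apply: contra nabH => /eqP/trivgP.
  by rewrite quotient_sub1 // => /subsetIP[_]; rewrite -/(abelian H).
have := Qn1; rewrite -(center_nil_eq1 nilQ) => /trivgPn[q qZ qn1].
have /setIP[/morphimP[g gN gH qE] qC] := qZ.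
exists g; split=> //; first by apply: contra qn1 => gZ; rewrite qE /= coset_id.
move=> y yH; have yN := subsetP nZ y yH.
apply: coset_idr; first by rewrite groupR.
rewrite morphR //=; apply/eqP/commgP.
by rewrite -qE; apply: (centP qC); apply: mem_quotient.
Qed.

(** * Rings whose units form a finite 2-group *)

Section UnitGroup.

Variables (R : pzRingType) (gT : finGroupType) (G : {group gT}) (f : gT -> R).
Hypothesis fM : {in G &, forall x y, f (x * y)%g = f x * f y}.
Hypothesis f_inj : {in G &, injective f}.
Hypothesis f_unit : forall u : R, ring_unit u <-> (exists2 x, x \in G & f x = u).

Lemma realize_unit u v : u * v = 1 -> v * u = 1 -> exists2 x, x \in G & f x = u.
Proof. by move=> uv vu; apply/f_unit; exists v. Qed.

Lemma realize1 : f 1%g = 1.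
Proof.
have [|v [uv _]] := (f_unit (f 1%g)).2; first by exists 1%g.
by rewrite -[LHS]mulr1 -uv mulrA -fM // mulg1.
Qed.

Lemma realizeX x n : x \in G -> f (x ^+ n)%g = f x ^+ n.
Proof.
move=> xG; elim: n => [|n IHn]; first by rewrite realize1.
by rewrite expgS exprS fM ?groupX // IHn.
Qed.

Lemma realizeV x : x \in G -> f x * f x^-1%g = 1.
Proof. by move=> xG; rewrite -fM ?groupV // mulgV realize1. Qed.

Lemma realizeVl x : x \in G -> f x^-1%g * f x = 1.
Proof. by move=> xG; rewrite -fM ?groupV // mulVg realize1. Qed.

Lemma realize_comm x y : x \in G -> y \in G -> f x * f y = f y * f x -> commute x y.
Proof. by move=> xG yG; rewrite -!fM // => /f_inj; apply; rewrite groupM. Qed.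

Lemma commute_realize x y : x \in G -> y \in G -> commute x y -> f x * f y = f y * f x.
Proof. by move=> xG yG cxy; rewrite -!fM // cxy. Qed.

Lemma realize_rreg x y z : x \in G -> y * f x = z * f x -> y = z.
Proof. by move=> xG /(congr1 ( *%R^~ (f x^-1%g))); rewrite -!mulrA realizeV // !mulr1. Qed.

(** A central idempotent d splits R as dR x (1 - d)R; the unit has the components
d u and 1 - d. *)
Lemma corner_unit d u v : d * d = d -> (forall x, d * x = x * d) ->
  d * (u * v) = d -> d * (v * u) = d ->
  exists2 y, y \in G & f y = d * u + (1 - d).
Proof.
move=> dd dC duv dvu.
have prod x y : d * (x * y) = d -> (d * x + (1 - d)) * (d * y + (1 - d)) = 1.
  move=> dxy; have d1 z : d * z * (1 - d) = 0.
    by rewrite mulrBr mulr1 -mulrA -dC mulrA dd subrr.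
  have d2 z : (1 - d) * (d * z) = 0 by rewrite mulrA mulrBl mul1r dd subrr mul0r.
  rewrite mulrDl (mulrDr (d * x)) (mulrDr (1 - d)) d1 d2 addr0 add0r.
  rewrite mulrBr mulr1 mulrBl mul1r dd subrr subr0.
  by rewrite -mulrA (mulrA x) -dC -!mulrA mulrA dd dxy addrC subrK.
by apply: (realize_unit (v := d * v + (1 - d))); apply: prod.
Qed.

(** For a central idempotent c, these are the units of (1 - c)R, embedded in G as
the units whose component in cR is 1. *)
Definition corner_stab (c : R) : {set gT} := [set g in G | c * f g == c].

Lemma corner_stabP c x : reflect (x \in G /\ c * f x = c) (x \in corner_stab c).
Proof. by rewrite inE; apply: (iffP andP) => -[xG /eqP]. Qed.

Lemma corner_stab_group_set c : group_set (corner_stab c).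
Proof.
apply/group_setP; split; first by apply/corner_stabP; rewrite group1 realize1 mulr1.
move=> x y /corner_stabP[xG fx] /corner_stabP[yG fy].
by apply/corner_stabP; rewrite groupM // fM // mulrA fx fy.
Qed.

Definition corner_stab_group c : {group gT} := Group (corner_stab_group_set c).

Lemma corner_stab_normal c : (forall x, c * x = x * c) -> (corner_stab_group c <| G)%g.
Proof.
move=> cC; apply/normalP; split=> [|y yG].
  by apply/subsetP=> x /corner_stabP[].
apply/eqP; rewrite eqEcard cardJg leqnn andbT; apply/subsetP=> _ /imsetP[x xc ->].
have /corner_stabP[xG fx] := xc.
apply/corner_stabP; rewrite groupJ // conjgE !fM ?groupM ?groupV //; split=> //.
by rewrite mulrA cC -mulrA [c * _]mulrA fx cC mulrA realizeVl // mul1r.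
Qed.

Hypothesis pG : (2.-group G)%g.

Lemma odd_expg_eq1 x m : x \in G -> odd m -> (x ^+ m = 1)%g -> x = 1%g.
Proof.
move=> xG om /eqP xm; apply/eqP; rewrite -order_eq1 -dvdn1.
have cop : coprime #[x]%g m.
  apply: pnat_coprime (mem_p_elt pG xG) _.
  by rewrite p'natE // dvdn2 om.
rewrite -(eqP cop) dvdn_gcd dvdnn order_dvdn; exact: xm.
Qed.

(** The unit 1 + x has order dividing m, as (1 + x)^m = 1 + m x, and G has no
nontrivial element of odd order. *)
Lemma odd_torsion_reduced (x : R) m : odd m -> x *+ m = 0 -> x * x = 0 -> x = 0.
Proof.
move=> om xm xx.
have [| |y yG fy] := @realize_unit (1 + x) (1 - x).
- by rewrite mulrDl mul1r mulrBr mulr1 xx subr0 subrK.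
- by rewrite mulrDr mulr1 mulrBl mul1r xx subr0 subrK.
have /(odd_expg_eq1 yG om) y1 : (y ^+ m = 1)%g.
  by apply: f_inj; rewrite ?groupX // realize1 realizeX // fy exprD1_sq0 // xm addr0.
by move: fy; rewrite y1 realize1 -[LHS]addr0 => /addrI.
Qed.

(** For an idempotent d both d x (1 - d) and (1 - d) x d have square zero. *)
Lemma odd_torsion_idem_central (d : R) m : odd m -> d *+ m = 0 -> d * d = d ->
  forall x, d * x = x * d.
Proof.
move=> om dm dd x.
have d0 : d * (1 - d) = 0 by rewrite mulrBr mulr1 dd subrr.
have d0' : (1 - d) * d = 0 by rewrite mulrBl mul1r dd subrr.
have /eqP : d * x * (1 - d) = 0.
  apply: (odd_torsion_reduced om); first by rewrite -!mulrnAl dm !mul0r.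
  by rewrite -!mulrA [(1 - d) * _]mulrA d0' mul0r !mulr0.
have /eqP : (1 - d) * x * d = 0.
  apply: (odd_torsion_reduced om); first by rewrite -mulrnAr dm mulr0.
  by rewrite -!mulrA [d * ((1 - d) * _)]mulrA d0 mul0r !mulr0.
rewrite !mulrBr !mulrBl !mulr1 !mul1r !subr_eq0 => /eqP E1 /eqP E2.
by rewrite E2 -E1.
Qed.

(** * The part of odd characteristic is commutative *)

Section OddPart.

Variables (n m : nat).
Hypothesis odd_m : odd m.
Hypothesis nm0 : (n * m)%:R = 0 :> R.
Hypothesis nn : (n * n)%:R = n%:R :> R.

Let e : R := n%:R.
Let l := (m.+1)./2.

Let ee : e * e = e. Proof. by rewrite /e -natrM nn. Qed.
Let em : e *+ m = 0. Proof. by rewrite /e -mulrnA nm0. Qed.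
Let eC x : e * x = x * e. Proof. exact/esym/commr_nat. Qed.
Let ek : e *+ (l * 2) = e.
Proof. by rewrite muln2 halfK /= odd_m subn0 mulrSr em add0r. Qed.

(** On eR the integer l is the inverse of 2, since 2 l = m + 1. *)
Lemma odd_part_halve : n%:R *+ (l * 2) = n%:R :> R.
Proof. exact: ek. Qed.

(** This d is the idempotent (1 + T)/2 of eR. *)
Lemma odd_part_idem (T : R) (d := e *+ l * (1 + T)) : T * T = 1 ->
  [/\ d * d = d, d * T = d, e * d = d, d *+ m = 0 & forall x, d * x = x * d].
Proof.
move=> TT.
have dT : d * T = d by rewrite /d -mulrA mulrDl mul1r TT addrC.
have ed : e * d = d by rewrite /d mulrA mulrnAr ee.
have dm : d *+ m = 0 by rewrite /d -mulrnAl -mulrnA mulnC mulrnA em mul0rn mul0r.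
have dd : d * d = d.
  rewrite {2}/d mulrA mulrnAr -eC ed mulrDr mulr1 mulrnAl dT -mulr2n -mulrnA.
  by rewrite -ed -mulrnAl ek.
by split=> //; apply: odd_torsion_idem_central odd_m dm dd.
Qed.

Definition odd_part : {group gT} := corner_stab_group (1 - e).

Lemma odd_partP x : reflect (x \in G /\ (1 - e) * f x = 1 - e) (x \in odd_part).
Proof. exact: corner_stabP. Qed.

Lemma odd_part_sub : odd_part \subset G.
Proof. by apply/subsetP=> x /odd_partP[]. Qed.

(** Below e, the units produced by a corner lie in the odd part. *)
Lemma odd_part_unit d u v : d * d = d -> (forall x, d * x = x * d) -> e * d = d ->
  d * (u * v) = d -> d * (v * u) = d ->
  exists2 y, y \in odd_part & f y = d * u + (1 - d).
Proof.
move=> dd dC ed duv dvu; have [y yG fy] := corner_unit dd dC duv dvu.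
exists y => //; apply/odd_partP; split=> //.
have ed0 : (1 - e) * d = 0 by rewrite mulrBl mul1r ed subrr.
by rewrite fy mulrDr mulrA ed0 mul0r add0r mulrBr ed0 mulr1 subr0.
Qed.

(** Let y be the unit with component 1 + h in dR, and set z = [g, h], z' = [g, y],
both central. Expanding g (1 + h) = (1 + h) g z' gives w h = v0 in dR with
w = d (z - z') and v0 = d (z' - 1). Moving g across w h multiplies it by z, but
v0 commutes with g; so w and v0, hence their sum d (z - 1), are fixed by z,
and (d (z - 1))^2 = 0. *)
Lemma odd_part_comm_corner d v g h :
  d * d = d -> (forall x, d * x = x * d) -> e * d = d -> d *+ m = 0 ->
  g \in odd_part -> (forall y, y \in odd_part -> [~ g, y]%g \in 'Z(odd_part)%g) ->
  h \in odd_part -> d * ((1 + f h) * v) = d -> d * (v * (1 + f h)) = d ->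
  d * (f g * f h) = d * (f h * f g).
Proof.
move=> dd dC ed dm gH g2 hH duv dvu.
have [y yH fy] := odd_part_unit dd dC ed duv dvu.
have sHG := subsetP odd_part_sub; have [[gG hG] yG] := (sHG g gH, sHG h hH, sHG y yH).
have comg x : x \in odd_part -> f g * f x = f x * f g * f [~ g, x]%g.
  by move=> xH; rewrite -!fM ?groupR ?groupM ?sHG // -commgC.
have zC x w : x \in odd_part -> w \in odd_part ->
    f [~ g, x]%g * f w = f w * f [~ g, x]%g.
  move=> xH wH; have /centerP[zH zw] := g2 x xH.
  by apply: commute_realize (zw w wH); apply: sHG.
move: (comg h hH) (comg y yH) (zC h g hH gH) (zC h h hH hH) (zC y g yH gH) (zC y h yH hH).
move: (f [~ g, h]%g) (f [~ g, y]%g) => z z' Eh Ey zg zh z'g z'h.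
have dy : d * f y = d * (1 + f h).
  by rewrite fy mulrDr mulrA dd mulrBr mulr1 dd subrr addr0.
have main : d * (1 + f h * z) = d * (1 + f h) * z'.
  apply: (realize_rreg gG); rewrite -[RHS]mulrA z'g -dy -[d * f y * _]mulrA.
  rewrite [f y * _]mulrA -Ey mulrA [d * f g]dC -[RHS]mulrA dy [RHS]mulrA -[f g * d]dC.
  by rewrite -!mulrA; congr (d * _); rewrite mulrDl mulrDr mul1r mulr1 Eh -!mulrA zg.
pose w := d * (z - z'); pose v0 := d * (z' - 1).
have wh : w * f h = v0.
  move: main; rewrite -mulrA !mulrDr mulrDl mulr1 mul1r mulrDr => main.
  rewrite /w -mulrA mulrBl zh z'h /v0 !mulrBr mulr1.
  by apply/eqP; rewrite subr_eq addrAC eq_sym subr_eq eq_sym -main addrC.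
have wg : w * f g = f g * w.
  by rewrite /w -mulrA mulrBl zg z'g -mulrBr mulrA dC -mulrA.
have vg : v0 * f g = f g * v0.
  by rewrite /v0 -mulrA mulrBl z'g mul1r -{2}[f g]mulr1 -mulrBr mulrA dC -mulrA.
have vz : v0 * z = v0.
  apply: (realize_rreg gG); rewrite -mulrA zg -wh -[LHS]mulrA [f h * _]mulrA -Eh.
  by rewrite [LHS]mulrA wg -[LHS]mulrA wh -vg.
have wz : w * z = w.
  by apply: (realize_rreg hG); rewrite -mulrA zh mulrA wh vz.
have vw : v0 + w = d * (z - 1).
  by rewrite /v0 /w -mulrDr addrC addrA subrK.
have dz : d * (z - 1) = 0.
  apply: (odd_torsion_reduced odd_m); first by rewrite -mulrnAl dm mul0r.
  have dvw : d * (v0 + w) = v0 + w by rewrite vw mulrA dd.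
  by rewrite -{1}vw mulrA -dC dvw mulrDl !mulrBr !mulr1 vz wz !subrr addr0.
move: dz; rewrite mulrBr mulr1 => /eqP; rewrite subr_eq0 => /eqP dz.
by rewrite Eh dC -mulrA -dC dz dC.
Qed.

(** Induction on the order of h. With T = h^(2^r), the idempotents a = (1 + T)/2
and b = (1 - T)/2 have sum e. On aR the order of h is at most 2^r, so the
induction hypothesis applies. On bR one has T = -1 and, for r > 0, the sum q of
the powers of -h below 2^r satisfies (1 + h) q = 1 - T = 2. *)
Lemma odd_part_comm_second_center r g h :
  g \in odd_part -> (forall y, y \in odd_part -> [~ g, y]%g \in 'Z(odd_part)%g) ->
  h \in odd_part -> (h ^+ (2 ^ r) = 1)%g -> commute g h.
Proof.
move=> gH g2; have sHG := subsetP odd_part_sub; have gG := sHG g gH.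
elim: r h => [|r IHr] h hH hr.
  by rewrite -[h]expg1 -(expn0 2) hr; apply: commute1.
have hG := sHG h hH.
pose T := f h ^+ (2 ^ r).
have TT : T * T = 1 by rewrite -exprD addnn -mul2n -expnS -realizeX // hr realize1.
have NTNT : (- T) * (- T) = 1 by rewrite mulrNN.
have [aa aT ea am aC] := odd_part_idem TT.
have [bb bT eb bm bC] := odd_part_idem NTNT.
move Da: (e *+ l * (1 + T)) aa aT ea am aC => a aa aT ea am aC.
move Db: (e *+ l * (1 - T)) bb bT eb bm bC => b bb bT eb bm bC.
have ab : a + b = e.
  by rewrite -Da -Db -mulrDr addrACA subrr addr0 -mulr2n mulrnAr mulr1 -mulrnA ek.
suff ecom : e * (f g * f h) = e * (f h * f g).
  apply: realize_comm => //; rewrite -[LHS]mul1r -[RHS]mul1r -(subrK e 1).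
  rewrite 2!(mulrDl (1 - e) e) ecom.
  case/odd_partP: gH => _ ge; case/odd_partP: hH => _ he.
  by rewrite [(1 - e) * _]mulrA [in RHS]mulrA ge he ge.
rewrite -ab !mulrDl; congr (_ + _).
  have ahh : a * (f h * f h^-1%g) = a by rewrite realizeV // mulr1.
  have ahh' : a * (f h^-1%g * f h) = a by rewrite realizeVl // mulr1.
  have [h' h'H fh'] := odd_part_unit aa aC ea ahh ahh'.
  have h'X k : f h' ^+ k = a * f h ^+ k + (1 - a).
    elim: k => [|k IHk]; first by rewrite !expr0 mulr1 addrC subrK.
    have a1 x : a * x * (1 - a) = 0.
      by rewrite mulrBr mulr1 -mulrA -aC mulrA aa subrr.
    have a2 x : (1 - a) * (a * x) = 0 by rewrite mulrA mulrBl mul1r aa subrr mul0r.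
    rewrite exprS IHk fh' mulrDl (mulrDr (a * f h)) (mulrDr (1 - a)) a1 a2 addr0 add0r.
    rewrite -mulrA [f h * (a * _)]mulrA -[f h * a]aC !mulrA aa -mulrA -exprS.
    by rewrite mulrBr mulr1 mulrBl mul1r aa subrr subr0.
  have cgh' : commute g h'.
    apply: IHr => //; apply: f_inj; rewrite ?groupX ?group1 ?sHG //.
    by rewrite realize1 realizeX ?sHG // h'X -/T aT addrC subrK.
  have afh : a * f h' = a * f h.
    by rewrite fh' mulrDr mulrA aa mulrBr mulr1 aa subrr addr0.
  have := commute_realize gG (sHG h' h'H) cgh'.
  move/(congr1 ( *%R a)); rewrite [X in X = _ -> _]mulrA [a * f g]aC -mulrA afh.
  by rewrite mulrA -[f g * a]aC -mulrA => ->; rewrite mulrA afh mulrA.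
(* For r = 0 the element 1 + h is zero on bR, but there h is the scalar -1. *)
case: r IHr hr @T TT NTNT aT bT Da Db => [|r] IHr hr T TT NTNT aT bT Da Db.
  have bh : b * f h = - b.
    by rewrite -{2}bT /T expn0 expr1 mulrN opprK.
  rewrite mulrA bC -mulrA bh mulrN mulrA bh mulNr.
  by rewrite -bC.
pose q := \sum_(i < 2 ^ r.+1) (- f h) ^+ i.
have hq : (1 + f h) * q = 1 - T.
  have := subrX1 (- f h) (2 ^ r.+1).
  rewrite exprNn -signr_odd oddX /= expr0 mul1r -/T -/q => E.
  by rewrite -[LHS]opprK -mulNr opprD addrC -E opprB.
have qh : q * (1 + f h) = 1 - T.
  rewrite -hq mulrDl mulrDr mul1r mulr1; congr (_ + _).
  rewrite mulr_suml mulr_sumr; apply: eq_bigr => i _.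
  exact/esym/commrX/commrN.
have b2 : b * (1 - T) *+ l = b.
  by rewrite mulrBr mulr1 -[b * T]opprK -mulrN bT opprK -mulr2n -mulrnA mulnC -eb -mulrnAl ek.
by apply: (odd_part_comm_corner bb bC eb bm (v := q *+ l));
  rewrite // ?mulrnAr ?mulrnAl ?mulrnAr ?hq ?qh.
Qed.

(** In a nonabelian nilpotent group the second center exceeds the center, but here
every element of the second center is central. *)
Lemma odd_part_abelian : abelian odd_part.
Proof.
have p2 : (2.-group odd_part)%g := pgroupS odd_part_sub pG.
apply/negPn/negP=> /(noncentral_second_center (pgroup_nil p2)) [g [gH gZ g2]].
case/negP: gZ; apply/centerP; split=> // h hH.
have [r oh] := p_natP (mem_p_elt p2 hH).
by apply: (odd_part_comm_second_center (r := r)) => //; rewrite -oh expg_order.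
Qed.

End OddPart.

(** * A cyclic subgroup that contains its polynomial units *)

Section CyclicCenter.

Variable a : gT.
Hypothesis aG : a \in G.
Hypothesis nonabG : ~~ abelian G.
Hypothesis sZA : 'Z(G)%g \subset <[a]>%g.
Hypothesis bicommA : forall g, g \in G -> bicommutes (f a) (f g) -> g \in <[a]>%g.

Lemma bicommutes_cycle g : g \in <[a]>%g -> bicommutes (f a) (f g).
Proof. by case/cycleP=> i -> r ra; rewrite realizeX //; exact: commrX. Qed.

Lemma cycle_involution_eq (x y : gT) : x \in <[a]>%g -> y \in <[a]>%g ->
  (x ^+ 2 = 1)%g -> (y ^+ 2 = 1)%g -> x != 1%g -> y != 1%g -> x = y.
Proof.
move=> xa ya x2 y2 x1 y1.
have ox : #[x]%g = 2 by apply: nt_prime_order.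
have oy : #[y]%g = 2 by apply: nt_prime_order.
have : (<[x]> == <[y]>)%g.
  by rewrite (eq_subG_cyclic (cycle_cyclic a)) ?cycle_subG // -!orderE ox oy.
move/eqP => xy; have : x \in <[y]>%g by rewrite -xy cycle_id.
by rewrite cycle2g // !inE (negPf x1) => /eqP.
Qed.

Lemma bicommutes_unit u v : bicommutes (f a) u -> u * v = 1 -> v * u = 1 ->
  exists2 g, g \in <[a]>%g & f g = u.
Proof.
move=> bu uv vu; have [g gG fg] := realize_unit uv vu.
by exists g => //; apply: bicommA; rewrite ?fg.
Qed.

(** Both u and v are images of the only involution of the cyclic group <a>. *)
Lemma bicommutes_sqrt1_eq u v : bicommutes (f a) u -> bicommutes (f a) v ->
  u * u = 1 -> v * v = 1 -> u != 1 -> v != 1 -> u = v.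
Proof.
move=> bu bv uu vv.
have [x xa fx] := bicommutes_unit bu uu uu; have [y ya fy] := bicommutes_unit bv vv vv.
have sa : <[a]>%g \subset G by rewrite cycle_subG.
have [xG yG] : x \in G /\ y \in G by split; apply: (subsetP sa).
rewrite -fx -fy -realize1 => x1 y1; congr (f _).
have sq1 z : z \in G -> f z * f z = 1 -> (z ^+ 2 = 1)%g.
  by move=> zG zz; apply: f_inj; rewrite ?groupX // realizeX // expr2 zz realize1.
apply: cycle_involution_eq => //; try by apply: sq1; rewrite ?fx ?fy.
  by apply: contraNneq x1 => ->.
by apply: contraNneq y1 => ->.
Qed.

(** Otherwise <a> contains two involutions: 1 - 2 e, and a central involution z of
G with e z = e. The latter exists because the units of (1 - e)R form a normal
subgroup of the 2-group G, which is nontrivial as the units of eR commute and G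
does not. *)
Lemma odd_idem_eq0 n m : odd m -> (n * m)%:R = 0 :> R -> (n * n)%:R = n%:R :> R ->
  n%:R = 0 :> R.
Proof.
move=> om nm0 nn; apply/eqP/negPn/negP => e0; set e : R := n%:R in e0.
have ee : e * e = e by rewrite -natrM.
have eC x : e * x = x * e by apply/esym/commr_nat.
have e2 : e + e != 0.
  apply: contra e0 => /eqP ee0.
  by have := odd_part_halve om nm0; rewrite -/e mulnC mulrnA mulr2n ee0 mul0rn => <-.
have cC x : (1 - e) * x = x * (1 - e) by rewrite mulrBl mulrBr mul1r mulr1 eC.
have cc : (1 - e) * (1 - e) = 1 - e.
  by rewrite mulrBl mul1r mulrBr mulr1 ee subrr subr0.
have [x xG nx] : exists2 x, x \in G & x \notin odd_part n.
  apply/subsetPn; apply: contra nonabG => sGo.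
  by apply: abelianS sGo _; apply: odd_part_abelian om nm0 nn.
have [||y yG fy] := corner_unit (u := f x) (v := f x^-1%g) cc cC.
- by rewrite realizeV // mulr1.
- by rewrite realizeVl // mulr1.
have fy' : f y = (1 - e) * f x + e by rewrite fy subKr.
have yK : y \in corner_stab_group e.
  apply/corner_stabP; split=> //; rewrite fy' mulrDr mulrA mulrBr mulr1 ee subrr.
  by rewrite mul0r add0r.
have Kn1 : corner_stab_group e != 1%g :> {set gT}.
  apply/trivgPn; exists y => //; apply: contra nx => /eqP y1.
  apply/odd_partP; split=> //.
  by apply/(addIr e); rewrite -fy' y1 realize1 subrK.
have K1 := meet_center_nil (pgroup_nil pG) (corner_stab_normal eC) Kn1.
have pK : (2.-group (corner_stab_group e :&: 'Z(G)))%g.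
  by apply: pgroupS pG; rewrite subIset // center_sub orbT.
have [_ dv _] := pgroup_pdiv pK K1.
have [z /setIP[zK zZ] oz] := Cauchy (isT : prime 2) dv.
have z1 : z != 1%g by rewrite -order_gt1 oz.
have z2 : (z ^+ 2 = 1)%g by rewrite -oz expg_order.
have /corner_stabP[zG ez] := zK.
have tt : (1 - e - e) * (1 - e - e) = 1.
  have ec : e * (1 - e) = 0 by rewrite mulrBr mulr1 ee subrr.
  rewrite mulrBl (mulrBr (1 - e)) cc cC ec (mulrBr e) ec ee.
  by rewrite subr0 sub0r opprK subrK.
have fz : f z = 1 - e - e.
  apply: bicommutes_sqrt1_eq => //.
  - exact/bicommutes_cycle/(subsetP sZA).
  - move=> r _; apply: commrB; last exact: commr_nat.
    by apply: commrB; [apply: commr1 | apply: commr_nat].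
  - by rewrite -expr2 -realizeX // z2 realize1.
  - by apply: contraNneq z1 => fz1; apply/eqP; apply: f_inj; rewrite ?group1 // realize1.
  - apply: contra e2; rewrite -addrA -opprD -[X in _ == X]subr0 => /eqP/addrI/oppr_inj/eqP.
    by [].
case/negP: e2; move: ez; rewrite fz !mulrBr mulr1 ee subrr sub0r => eN.
by rewrite -{1}eN addNr.
Qed.

Lemma bicommutes_natrD c u : bicommutes (f a) u -> bicommutes (f a) (c%:R + u).
Proof. by move=> bu r ra; apply: commrD; [apply: commr_nat | apply: bu]. Qed.

(** In characteristic 2 the element x = 1 + f a is nilpotent. If x^k is its
first vanishing power and k > 4, then 1 + x^(k-1) and 1 + x^(k-2) both have square
1, hence are equal; multiplying by x gives x^(k-1) = 0. *)
Lemma char2_order_le4 : 2%:R = 0 :> R -> (1 : R) != 0 -> (a ^+ 4 = 1)%g.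
Proof.
move=> two0 one0.
have dbl (u : R) : u + u = 0 by rewrite -mulr2n -mulr_natr two0 mulr0.
pose x := 1 + f a.
have bxX k : bicommutes (f a) (x ^+ k).
  by move=> r ra; apply/commrX/commrD; [apply: commr1 | ].
have xX j : x ^+ (2 ^ j) = 1 + f a ^+ (2 ^ j).
  elim: j => [|j IHj]; first by rewrite !expr1.
  rewrite expnSr exprM IHj expr2 mulrDl mul1r mulrDr mulr1 -exprD addnn -muln2 -expnSr.
  by rewrite addrA -[1 + _ + _]addrA dbl addr0.
have [j oa] := p_natP (mem_p_elt pG aG).
have exN : exists k, x ^+ k == 0.
  by exists (2 ^ j)%N; rewrite xX -oa -realizeX // expg_order realize1 dbl.
have a4 : x ^+ 4 = 0 -> (a ^+ 4 = 1)%g.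
  rewrite (xX 2) -(dbl 1) => /addrI a4; apply: f_inj; rewrite ?groupX //.
  by rewrite realize1 realizeX.
case: (ex_minnP exN) => k /eqP xk kmin.
have [k4|] := leqP k 4; first by apply: a4; rewrite -(subnK k4) exprD xk mulr0.
case: k xk kmin => [|[|[|k]]] // xk kmin k4.
have sq i : (k < i)%N -> (1 + x ^+ i) * (1 + x ^+ i) = 1.
  move=> ki; rewrite mulrDl mul1r mulrDr mulr1 addrA -[1 + _ + _]addrA dbl addr0 -exprD.
  have ki3 : (k.+3 <= i + i)%N by lia.
  by rewrite -(subnK ki3) exprD xk mulr0 addr0.
have nz i : (i < k.+3)%N -> x ^+ i != 0.
  by move=> ik; apply: contraTneq ik => /eqP/kmin; rewrite leqNgt.
have neq1 i : (i < k.+3)%N -> 1 + x ^+ i != 1.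
  by move=> ik; rewrite -subr_eq0 addrC addKr nz.
have b1 i : bicommutes (f a) (1 + x ^+ i) by apply: (@bicommutes_natrD 1).
have /addrI/(congr1 ( *%R x)) : 1 + x ^+ k.+2 = 1 + x ^+ k.+1.
  by apply: bicommutes_sqrt1_eq; rewrite ?sq ?neq1.
by rewrite -!exprS xk => /esym/eqP; rewrite (negPf (nz _ _)).
Qed.

(** The element of order 2 in <a> is mapped to -1, the other square root of 1. *)
Lemma sqrtN1_pow n : #[a]%g = (2 ^ n.+3)%N -> 2%:R != 0 :> R -> f (a ^+ (2 ^ n))%g ^+ 4 = -1.
Proof.
move=> oa two0; rewrite -realizeX ?groupX // -expgM -(expnD 2 n 2).
have aX : (a ^+ (2 ^ (n + 2)))%g \in <[a]>%g by apply: mem_cycle.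
apply: bicommutes_sqrt1_eq.
- exact: bicommutes_cycle.
- by move=> r _; apply: commrN1.
- rewrite -expr2 -realizeX ?groupX // -expgM -expnSr addn2 -oa expg_order.
  exact: realize1.
- by rewrite mulrNN mulr1.
- apply/negP=> /eqP E; have : (a ^+ (2 ^ (n + 2)))%g == 1%g.
    by apply/eqP/f_inj; rewrite ?groupX // realize1.
  by rewrite -order_dvdn oa dvdn_Pexp2l // addn2 ltnn.
by rewrite -subr_eq0 -opprD oppr_eq0.
Qed.

Section OrderAtLeast8.

Variable n : nat.
Hypothesis oa : #[a]%g = (2 ^ n.+3)%N.
Hypothesis one0 : (1 : R) != 0.
Hypothesis two0 : 2%:R != 0 :> R.

(** Evaluation of polynomials at a primitive eighth root of unity of R. *)
Lemma eval_zeta8 : exists ev : {rmorphism {poly int} -> R},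
  ev ('X ^+ 4 + 1) = 0 /\ forall p, bicommutes (f a) (ev p).
Proof.
have [ev evX] := int_poly_eval (f (a ^+ (2 ^ n))%g) one0.
exists ev; split; first by rewrite rmorphD rmorphXn rmorph1 /= evX sqrtN1_pow // addNr.
move=> p r ra; apply: int_poly_eval_comm; rewrite evX realizeX //; exact: commrX.
Qed.

(** With s = sqrt 2, the inverse units (1 + s)^2 and (s - 1)^2 = (1 - s)^2 have sum
6, and both become 1 after n + 3 squarings. The sum of the iterated squares is
then 2, and also an integer c' > 2. *)
Lemma finite_char : exists2 N, (0 < N)%N & N%:R = 0 :> R.
Proof.
have [ev [evX evb]] := eval_zeta8.
pose s : {poly int} := 'X - 'X^3.
have evs2 : ev (s ^+ 2 - 2) = 0.
  have -> : s ^+ 2 - 2 = ('X^4 + 1) * ('X^2 - 2) by rewrite /s; ring.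
  by rewrite rmorphM evX mul0r.
have uv : ev ((1 + s) ^+ 2) * ev ((s - 1) ^+ 2) = 1.
  apply/eqP; rewrite -subr_eq0 -rmorphM -[X in _ - X](rmorph1 ev) -rmorphB /=.
  have -> : (1 + s) ^+ 2 * (s - 1) ^+ 2 - 1 = (s ^+ 2 - 2) * s ^+ 2 by ring.
  by rewrite rmorphM /= evs2 mul0r.
have vu : ev ((s - 1) ^+ 2) * ev ((1 + s) ^+ 2) = 1 by rewrite -rmorphM mulrC rmorphM.
have uvc : ev ((1 + s) ^+ 2) + ev ((s - 1) ^+ 2) = 6%:R.
  apply/eqP; rewrite -subr_eq0 -rmorphD -[X in _ - X](rmorph_nat ev) -rmorphB /=.
  have -> : (1 + s) ^+ 2 + (s - 1) ^+ 2 - 6%:R = (s ^+ 2 - 2) * 2 by ring.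
  by rewrite rmorphM /= evs2 mul0r.
have [g ga fg] := bicommutes_unit (evb _) uv vu.
have gG : g \in G by apply: subsetP ga; rewrite cycle_subG.
have uK : ev ((1 + s) ^+ 2) ^+ (2 ^ n.+3) = 1.
  rewrite -fg -realizeX // -oa; case/cycleP: ga => i ->.
  by rewrite -expgM mulnC expgM expg_order expg1n realize1.
have vK : ev ((s - 1) ^+ 2) ^+ (2 ^ n.+3) = 1.
  rewrite -[LHS]mul1r -{1}uK -exprMn_comm ?uv ?expr1n //.
  by rewrite /GRing.comm uv vu.
have [c' c2 E] := inverse_pair_pow2_sum n.+3 uv vu uvc isT.
exists (c' - 2)%N; first by rewrite subn_gt0.
by rewrite natrB ?(ltnW c2) // -E uK vK subrr.
Qed.

(** If N = q m, the residue e with e = 0 mod q and e = 1 mod m is idempotent in R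
and is killed by m, so it vanishes by odd_idem_eq0, while e q = q. *)
Lemma pow2_char : exists k, (2 ^ k)%:R = 0 :> R.
Proof.
have [N N0 NR] := finite_char.
have [m om Nm] : exists2 m, odd m & N = (2 ^ logn 2 N * m)%N.
  exists (N %/ 2 ^ logn 2 N)%N; last by rewrite mulnC divnK // pfactor_dvdnn.
  have [k ck NE] := pfactor_coprime (isT : prime 2) N0.
  by rewrite {1}NE mulnK ?expn_gt0 // -coprime2n.
set q := (2 ^ logn 2 N)%N in Nm; exists (logn 2 N); rewrite -/q.
have modN x y : x = y %[mod N] -> x%:R = y%:R :> R.
  move=> xy; rewrite (divn_eq x N) (divn_eq y N) xy !natrD !natrM NR.
  by rewrite !mulr0.
have co : coprime q m by rewrite coprimeXl // coprime2n.
pose e := chinese q m 0 1.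
have eq0 : e = 0 %[mod q] := chinese_modl co 0 1.
have em1 : e = 1 %[mod m] := chinese_modr co 0 1.
have e0 : e%:R = 0 :> R.
  apply: (odd_idem_eq0 om).
    apply: (modN _ 0%N); rewrite Nm; apply/eqP; rewrite mod0n.
    by rewrite -/(dvdn _ _) dvdn_mul // /dvdn eq0 mod0n.
  apply: modN; apply/eqP; rewrite Nm chinese_remainder //.
  by rewrite -modnMm eq0 em1 -(modnMm e e m) em1 !modnMm mod0n !eqxx.
suff: (e * q)%:R = q%:R :> R by rewrite natrM e0 mul0r.
apply: modN; apply/eqP.
by rewrite Nm chinese_remainder // modnn modnMl eqxx -modnMml em1 modnMml mul1n eqxx.
Qed.

(** If 2^(k+3) is the characteristic, 1 + 2^(k+2) has square 1 and differs from 1,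
so it is -1; multiplying 2 + 2^(k+2) = 0 by 2^(k+1) gives 2^(k+2) = 0. *)
Lemma char_4 : 4%:R = 0 :> R.
Proof.
have exk : exists k, (2 ^ k)%:R == 0 :> R by have [k /eqP] := pow2_char; exists k.
case: (ex_minnP exk) => -[|[|[|k]]] /eqP kR kmin //.
- by case/eqP: one0.
- by case/eqP: two0.
have nz i : (i < k.+3)%N -> (2 ^ i)%:R != 0 :> R.
  by move=> ik; apply: contraTneq ik => /eqP/kmin; rewrite leqNgt.
case/eqP: (nz k.+2 (ltnSn _)).
have big i : (k.+3 <= i)%N -> (2 ^ i)%:R = 0 :> R.
  by move=> ki; rewrite -(subnK ki) expnD natrM kR mulr0.
have : 1 + (2 ^ k.+2)%:R = -1 :> R.
  apply: bicommutes_sqrt1_eq.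
  - by move=> r _; apply: commrD; [apply: commr1 | apply: commr_nat].
  - by move=> r _; apply: commrN1.
  - rewrite mulrDl mul1r mulrDr mulr1 -natrM -expnD -addrA [X in _ + X]addrA -natrD.
    by rewrite addnn -muln2 -expnSr !big ?addr0 //; lia.
  - by rewrite mulrNN mulr1.
  - by rewrite -subr_eq0 addrC addKr nz.
  by rewrite -subr_eq0 -opprD oppr_eq0.
move/(congr1 ( *%R (2 ^ k.+1)%:R)); rewrite mulrDr mulrN mulr1 -natrM -expnD.
rewrite (big (k.+1 + k.+2)%N) ?addr0; last by lia.
move/eqP; rewrite -subr_eq0 opprK -natrD addnn -muln2 -expnSr => /eqP; exact.
Qed.

(** In characteristic 4, with s = b - b^3 a square root of 2, the square of
1 + 2 s is 1. It is not -1, as 2 (s + 1) = 0 would give 2 = 0, so 2 s = 0. Modulo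
4, 2 s and b^4 + 1 the square of 1 + z is 1 for z = (b^2 - 1) (1 - b), whereas z is
neither 0 nor -2: z divides 2, and z is a multiple of z + 2. *)
Lemma order_ge8_absurd : False.
Proof.
have [ev [evX evb]] := eval_zeta8; have four := char_4.
have ev4 : ev 4%:R = 0 by rewrite rmorph_nat.
have ev2 : ev 2%:R != 0 by rewrite rmorph_nat.
have evD p q : ev p = 0 -> ev q = 0 -> ev (p + q) = 0.
  by rewrite rmorphD => -> ->; rewrite addr0.
have evM p q : ev p = 0 -> ev (p * q) = 0 by rewrite rmorphM => ->; rewrite mul0r.
pose s : {poly int} := 'X - 'X^3.
have sqrt1 p : ev ((1 + p) ^+ 2 - 1) = 0 -> ev p = 0 \/ ev (p + 2) = 0.
  rewrite rmorphB rmorph1 rmorphXn /= => /eqP; rewrite subr_eq0 => /eqP pp.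
  have [p0|p0] := eqVneq (ev p) 0; [by left | right].
  suff: ev (1 + p) = -1.
    by rewrite !rmorphD rmorph1 => /eqP; rewrite -subr_eq0 opprK addrAC addrC => /eqP.
  apply: bicommutes_sqrt1_eq; rewrite -?expr2 ?expr1n ?sqrrN ?expr1n //.
  - by move=> r _; apply: commrN1.
  - by rewrite rmorphD rmorph1 -subr_eq0 addrC addKr.
  by rewrite -subr_eq0 -opprD oppr_eq0.
have s2 : ev (s * 2) = 0.
  have [| |s20] := sqrt1 (s * 2) _ => //.
    have -> : (1 + s * 2) ^+ 2 - 1 = 4 * (s + s ^+ 2) :> {poly int} by ring.
    by rewrite rmorphM /= ev4 mul0r.
  case/eqP: ev2.
  have -> : 2 = (s * 2 + 2) * (1 - s) + 4 + ('X^4 + 1) * (2 * ('X^2 - 2)) :> {poly int}.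
    by rewrite /s; ring.
  by apply: (evD _ _ _ (evM _ _ evX)); apply: (evD _ _ _ ev4); apply: evM.
pose z : {poly int} := ('X^2 - 1) * (1 - 'X).
have ideal p q r t : p = 4 * q + s * 2 * r + ('X^4 + 1) * t -> ev p = 0.
  by move=> ->; apply: (evD _ _ _ (evM _ _ evX)); apply: evD; apply: evM.
have z0 : ev z != 0.
  apply: contra ev2 => /eqP evz.
  (* From z (1 + X) = -(X^2 - 1)^2 = 2 X^2 modulo X^4 + 1. *)
  have -> : 2 = z * (- ((1 + 'X) * 'X^2)) + ('X^4 + 1) * (2 - 'X^2) :> {poly int}.
    by rewrite /z; ring.
  by apply/eqP/evD; apply: evM.
have [|evz|evz2] := sqrt1 z; last 2 first.
- by case/eqP: z0.
(* With w = X^2 - 1, z (2 + X) = z - w^2 and w^2 = -2 in R; moreover 2 + X has the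
   inverse k, as (2 + X) (X - 2) = X^2 modulo 4 and X^4 = -1 in R. *)
- case/eqP: z0; pose k : {poly int} := 'X^2 * (2 - 'X).
  have : ev (z - (z + 2) * k) = 0.
    apply: (ideal _ (- z * 'X^2) (k * 'X^3) (z - k * (1 + 2 * (1 - 'X^2)))).
    by rewrite /k /z /s; ring.
  by rewrite rmorphB (rmorphM ev _ k) /= evz2 mul0r subr0.
apply: (ideal _ ('X^3 - 'X^4) (- 'X - 'X^3 * ('X - 1))
  ((1 - 'X) ^+ 2 + 2 * ('X - 1) * (1 - 'X^2))).
by rewrite /z /s; ring.
Qed.

End OrderAtLeast8.

(** The two properties of <a> behind this bound are that it contains the center of
G and every unit in the bicommutant of f a. Both hold for a cyclic center and for
a cyclic maximal abelian subgroup. *)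
Lemma order_2_or_4 : #[a]%g = 2 \/ #[a]%g = 4.
Proof.
have one0 : (1 : R) != 0.
  apply: contra nonabG => /eqP one0; apply/centsP=> x xG y yG.
  have triv u : u = 0 :> R by rewrite -[u]mul1r one0 mul0r.
  by apply: realize_comm; rewrite // [LHS]triv [RHS]triv.
have [r oa] := p_natP (mem_p_elt pG aG).
case: r oa => [|[|[|n]]] oa; [|by left|by right|exfalso].
  case/negP: nonabG; have a1 : <[a]>%g = 1%g.
    by apply/eqP; rewrite cycle_eq1 -order_eq1 oa.
  have /eqP : 'Z(G)%g == 1%g by rewrite -subG1 -a1.
  by move/eqP; rewrite (center_nil_eq1 (pgroup_nil pG)) => /eqP->; apply: abelian1.
have [two0|two0] := eqVneq (2%:R : R) 0; last exact: order_ge8_absurd oa one0 two0.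
have /eqP := char2_order_le4 two0 one0.
by rewrite -order_dvdn oa (dvdn_Pexp2l n.+3 2).
Qed.

End CyclicCenter.
End UnitGroup.

Lemma isog_Zp_2_or_4 (gT : finGroupType) (A : {group gT}) : cyclic A ->
  #|A| = 2 \/ #|A| = 4 -> A \isog Zp 2 \/ A \isog Zp 4.
Proof.
have cyclic_Zp p : cyclic (Zp p.+2).
  by apply/cyclicP; exists Zp1; apply: (Zp_cycle p.+1).
by move=> cA [] oA; [left | right];
  rewrite (isog_cyclic_card [group of Zp _]) // cyclic_Zp card_Zp ?oA.
Qed.

Lemma maximal_abelian_cent (gT : finGroupType) (G A : {group gT}) (x : gT) :
  maximal_abelian G A -> x \in 'C_G(A)%g -> x \in A.
Proof.
case/maxgroupP=> /andP[sAG abA] maxA /setIP[xG xC].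
suff <- : (A <*> <[x]>)%g = A by rewrite mem_gen // inE cycle_id orbT.
apply: (maxA (A <*> <[x]>)%G); rewrite ?joing_subl // join_subG sAG cycle_subG xG.
by rewrite abelianY abA cycle_abelian cycle_subG.
Qed.

Local Open Scope group_scope.

Theorem proposition7p1 (gT : finGroupType) (G : {group gT})
    (nonabG : ~~ abelian G) (pG : 2.-group G) (realG : realizable G) :
  (cyclic 'Z(G) -> 'Z(G) \isog Zp 2 \/ 'Z(G) \isog Zp 4) /\
  (forall A : {group gT}, maximal_abelian G A -> cyclic A ->
     A \isog Zp 2 \/ A \isog Zp 4).
Proof.
have [R [f [fM f_inj f_unit]]] := realG.
split=> [cZ | A maxA cA]; apply: isog_Zp_2_or_4 => //=.
  have [a Za] := cyclicP cZ.
  have aZ : a \in 'Z(G) by rewrite Za cycle_id.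
  have aG : a \in G by apply: subsetP aZ; apply: center_sub.
  rewrite Za; apply: (order_2_or_4 fM f_inj f_unit pG aG nonabG); rewrite -?Za // => g gG bg.
  apply/centerP; split=> // h hG; apply: (realize_comm fM f_inj) => //.
  by apply/esym/bg/(commute_realize fM) => //; apply/commute_sym; case/centerP: aZ => _; apply.
have [/andP[sAG abA] _] := maxgroupP maxA.
have [a Aa] := cyclicP cA.
have aA : a \in A by rewrite Aa cycle_id.
have aG := subsetP sAG a aA.
rewrite Aa; apply: (order_2_or_4 fM f_inj f_unit pG aG nonabG); rewrite -?Aa.
  apply/subsetP=> x /setIP[xG xC]; apply: maximal_abelian_cent maxA _.
  by rewrite inE xG (subsetP (centS sAG)).
move=> g gG bg; apply: maximal_abelian_cent maxA _; rewrite inE gG /= Aa cent_cycle.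
by apply/cent1P/commute_sym/(realize_comm fM f_inj) => //; apply: bg.
Qed.
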